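(* Let $M_1\le M_2$ be positive integers and $d=\gcd(M_1,M_2)$. Then the equation $$X^2+Y^2-M_1X-M_2Y+XY=0$$ has a unique solution $(X,Y)\in\mathbb{N}\times\mathbb{N}$ (namely $(X,Y)=(M_1,M_2-M_1)$ if $M_1<M_2$, and $(X,Y)=(\frac23M_1,\frac23M_1)$ if $M_1=M_2$) if and only if all the following conditions hold: (1) every prime factor of $d$ is $2$, $3$, or of the form $6k-1$ for some $k\in\mathbb{N}$; (2) if $M_1=M_2$ then $3$ divides $d$; (3) if $M_2\notin\{M_1,2M_1\}$ then $3$ does not divide $d$ and $\dfrac{M_1^2+M_2^2-M_1M_2}{d^2}$ is a prime of the form $6m+1$ for some $m\in\mathbb{N}$.
   Context: $\mathbb{N}$ denotes the positive integers. *)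

(* Defs.v *)
(* Elements of the set N of positive integers are rendered as
   n : nat together with 0 < n. *)
From mathcomp Require Import all_boot all_order all_algebra.
Set Implicit Arguments.
Unset Strict Implicit.
Unset Printing Implicit Defensive.

Import GRing.Theory Num.Theory.

(* The equation lives in int, where its subtractions are not truncated. *)
Definition pos_solution (M1 M2 : nat) (XY : nat * nat) : Prop :=
  let X : int := XY.1 in
  let Y : int := XY.2 in
  [/\ (0 < XY.1)%N, (0 < XY.2)%N
    & (X ^+ 2 + Y ^+ 2 - M1%:Z * X - M2%:Z * Y + X * Y = 0)%R].

(* The subtraction in nat is not truncated, as 0 < k. *)
Definition form_6k_minus_1 (p : nat) : Prop :=
  exists2 k : nat, 0 < k & p = 6 * k - 1.

Definition form_6m_plus_1 (p : nat) : Prop :=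
  exists2 m : nat, 0 < m & p = 6 * m + 1.

Definition norm_quotient (M1 M2 : nat) : rat :=
  ((M1%:R ^+ 2 + M2%:R ^+ 2 - M1%:R * M2%:R) / (gcdn M1 M2)%:R ^+ 2)%R.

(* Main.v *)
(* Write Q(a, b) = a^2 + a b + b^2. On the line through the origin of direction
   (a, b), a and b positive and coprime, there is a positive integer point of the
   conic iff Q(a, b) divides M1 a + M2 b. Put M1 = d m and M2 = d (m + c) with m, c
   coprime; for c > 0 the known solution has direction (m, c).
   A prime p = 1 mod 3 is p = Q(a, b) (Thue). If p | d then (a, b) and (b, a) both
   give solutions; if p | Q(m, c) then one of them does, so uniqueness forces
   Q(m, c) = p.
   Conversely the primes dividing Q(a, b) are 3 (with exponent at most 1) or
   1 mod 3, and one that divides M1 a + M2 b but not d divides Q(m, c), the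
   quotient (M1^2 + M2^2 - M1 M2) / d^2. This leaves only a = b = 1 when
   Q(m, c) is 1 or 3, and only (a, b) = (m, c) when it is a prime = 1 mod 3. *)

Require Import Defs.
From mathcomp Require Import all_boot all_order all_algebra.
From mathcomp Require Import finfield zify ring.
Import GRing.Theory Num.Theory.

(** * Positive points of the conic and coprime directions *)

Lemma pos_solutionE M1 M2 X Y :
  pos_solution M1 M2 (X, Y) <->
  [/\ 0 < X, 0 < Y & X ^ 2 + X * Y + Y ^ 2 = M1 * X + M2 * Y].
Proof. by rewrite /pos_solution /=; split=> -[X0 Y0 e]; split=> //; lia. Qed.

Lemma pos_solution_of_dvd M1 M2 a b :
  0 < M1 -> 0 < a -> 0 < b -> a ^ 2 + a * b + b ^ 2 %| M1 * a + M2 * b ->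
  exists2 g, 0 < g & pos_solution M1 M2 (g * a, g * b).
Proof.
move=> M0 a0 b0 /dvdnP[g e].
have g0 : 0 < g by case: g e => //; rewrite mul0n => /eqP; rewrite addn_eq0 muln_eq0; lia.
exists g => //; apply/pos_solutionE; rewrite !muln_gt0 g0 a0 b0; split=> //.
transitivity (g * (g * (a ^ 2 + a * b + b ^ 2))); first by ring.
by rewrite -e; ring.
Qed.

(** Divide by g = gcd(X, Y): both sides of the equation then share one factor g, which cancels. *)
Lemma pos_solution_coprime M1 M2 X Y :
  pos_solution M1 M2 (X, Y) ->
  exists g a b, [/\ X = g * a, Y = g * b, [/\ 0 < g, 0 < a & 0 < b], coprime a b
                 & g * (a ^ 2 + a * b + b ^ 2) = M1 * a + M2 * b].
Proof.
move/pos_solutionE => [X0 Y0 e].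
have g0 : 0 < gcdn X Y by rewrite gcdn_gt0 X0.
have EX : X = gcdn X Y * (X %/ gcdn X Y) by rewrite mulnC divnK // dvdn_gcdl.
have EY : Y = gcdn X Y * (Y %/ gcdn X Y) by rewrite mulnC divnK // dvdn_gcdr.
have co : coprime (X %/ gcdn X Y) (Y %/ gcdn X Y).
  by rewrite /coprime -(eqn_pmul2l g0) muln_gcdr -EX -EY muln1.
move: (gcdn X Y) (X %/ _) (Y %/ _) g0 EX EY co => g a b g0 EX EY co.
exists g, a, b; subst X Y; move: X0 Y0; rewrite !muln_gt0 => /andP[_ a0] /andP[_ b0].
split=> //; apply/eqP; rewrite -(eqn_pmul2l g0); apply/eqP.
have -> : g * (M1 * a + M2 * b) = M1 * (g * a) + M2 * (g * b) by ring.
by rewrite -e; ring.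
Qed.

(** * Prime divisors of Q(a, b) for coprime a, b *)

Lemma not_9_dvd_norm a b : coprime a b -> ~~ (9 %| a ^ 2 + a * b + b ^ 2).
Proof.
move=> co; apply/negP => d9.
suff [a3 b3] : 3 %| a /\ 3 %| b by have := dvdn_gcd 3 a b; rewrite a3 b3 (eqP co).
(* A finite check on residues mod 9: 9 divides Q(i, j) only if 3 divides both i and j. *)
have chk : all (fun i => all (fun j => (9 %| i ^ 2 + i * j + j ^ 2) ==>
    (3 %| i) && (3 %| j)) (iota 0 9)) (iota 0 9) by [].
have mem n : n %% 9 \in iota 0 9 by rewrite mem_iota ltn_mod.
have /implyP := allP (allP chk _ (mem a)) _ (mem b).
rewrite /dvdn !modn_dvdm // => H; apply/andP/H.
by rewrite -modnDm modnXm -[((a %% 9) ^ 2 + _) %% 9]modnDm modnXm modnMm (modnDm (a ^ 2)) modnDm.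
Qed.

Section CubeRoot.
Local Open Scope ring_scope.
Variable F : finFieldType.

Lemma subrX3_1 (x : F) : x ^+ 3 - 1 = (x - 1) * (x ^+ 2 + x + 1).
Proof. by ring. Qed.

(** Here x^3 = 1 and x is not 1, so x^|F| = x reduces to x^r = x with r = |F| mod 3; both r = 0 and
    r = 2 would give x = 1. *)
Lemma cube_root_card (x : F) : x ^+ 2 + x + 1 = 0 -> 3%:R != 0 :> F -> (#|F| %% 3 = 1)%N.
Proof.
move=> x0 n3.
have x3 : x ^+ 3 = 1 by apply/eqP; rewrite -subr_eq0 subrX3_1 x0 mulr0.
have nx : x != 1 by apply: contraNneq n3 => x1; rewrite -x0 x1; apply/eqP; ring.
have := expf_card x; rewrite {1}(divn_eq #|F| 3) exprD mulnC exprM x3 expr1n mul1r.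
have : (#|F| %% 3 < 3)%N by rewrite ltn_mod.
case: (#|F| %% 3)%N => [|[|[|//]]] _ //.
  by move=> x1; rewrite -x1 eqxx in nx.
move=> xx; have xz : x != 0 by apply/eqP => z; move/eqP: x0; rewrite z expr0n /= !add0r oner_eq0.
by case/negP: nx; apply/eqP/(mulfI xz); rewrite mulr1.
Qed.

(* Some nonzero y is not a root of X^((#|F|-1)/3) - 1; take x = y^((#|F|-1)/3). *)
Lemma cube_root_exists : (#|F| %% 3 = 1)%N -> exists x : F, x ^+ 2 + x + 1 = 0.
Proof.
move=> cF; set k := (#|F| %/ 3)%N.
have Fk : #|F| = (3 * k).+1 by rewrite {1}(divn_eq #|F| 3) cF addn1 mulnC.
have k0 : (0 < k)%N by have := finNzRing_gt1 F; rewrite Fk; case: k {Fk}.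
have [y y0 yk] : exists2 y : F, y != 0 & y ^+ k != 1.
  suff /existsP[y /andP[y0 yk]] : [exists y : F, (y != 0) && (y ^+ k != 1)] by exists y.
  apply: contraT => /existsPn H.
  have all1 : all k.-unity_root (enum (predC1 (0 : F))).
    apply/allP => y; rewrite mem_enum !inE => y0; rewrite unity_rootE.
    by have := H y; rewrite y0 /= negbK.
  have := max_unity_roots k0 all1 (enum_uniq _).
  by rewrite -cardE cardC1 Fk /=; lia.
have y3 : (y ^+ k) ^+ 3 = 1.
  by apply: (mulfI y0); rewrite mulr1 -exprM -exprS mulnC -Fk expf_card.
exists (y ^+ k); have nz : y ^+ k - 1 != 0 by rewrite subr_eq0.
apply: (mulfI nz); rewrite mulr0.
by rewrite -subrX3_1 y3 subrr.
Qed.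
End CubeRoot.

Lemma Fp_nat_eq0 p n : prime p -> (p %| n) = (n%:R == 0 :> 'F_p)%R.
Proof. by move=> pp; rewrite (dvdn_pcharf (pchar_Fp pp)). Qed.

Lemma prime_dvd_norm_ndvdl a b r : coprime a b -> prime r ->
  r %| a ^ 2 + a * b + b ^ 2 -> ~~ (r %| a).
Proof.
move=> co pr rQ; apply/negP => ra.
have rb : r %| b.
  move: rQ; rewrite dvdn_addr; first by rewrite Euclid_dvdX // andbT.
  by rewrite dvdn_add ?dvdn_mulr // expnS dvdn_mulr.
by have := dvdn_gcd r a b; rewrite ra rb (eqP co) dvdn1 => /eqP r1; rewrite r1 in pr.
Qed.

(** If r is not 3, then a / b is a root of x^2 + x + 1 in the field with r elements, whose size is
    therefore 1 mod 3. *)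
Lemma prime_dvd_norm a b r :
  coprime a b -> prime r -> r %| a ^ 2 + a * b + b ^ 2 -> r = 3 \/ r %% 3 = 1.
Proof.
move=> co pr rQ; have := rQ; rewrite Fp_nat_eq0 // !natrD natrM !natrX => /eqP Q0.
have ra := prime_dvd_norm_ndvdl _ _ _ co pr rQ.
have [->|r3] := eqVneq r 3; [by left | right].
have b0 : (b%:R != 0 :> 'F_r)%R.
  apply/eqP => b0; move/eqP: Q0; rewrite b0 mulr0 expr0n /= !addr0 expf_eq0 /=.
  by rewrite -Fp_nat_eq0 // (negbTE ra).
have := @cube_root_card 'F_r (a%:R / b%:R)%R; rewrite card_Fp //; apply.
  apply: (mulfI (expf_neq0 2 b0)); rewrite mulr0 -Q0; field; exact: b0.
by rewrite -Fp_nat_eq0 // dvdn_prime2.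
Qed.

(** * Primes 1 mod 3 as values of Q *)

Lemma prime_sqrt_bracket p : prime p -> exists2 k, k ^ 2 < p & p < k.+1 ^ 2.
Proof.
move=> pp.
have ex : exists k, p < k.+1 ^ 2 by exists p; nia.
case: (ex_minnP ex) => k pk kmin; exists k => //.
rewrite ltn_neqAle; apply/andP; split.
  apply: contraTneq pp => <-; rewrite expnS expn1; case: (k) => [|[|n]] //.
  by apply/primePn; right; exists n.+2; rewrite ?dvdn_mulr //; nia.
case: k pk kmin => // k _ kmin.
by rewrite leqNgt; apply/negP => /kmin; rewrite ltnn.
Qed.

(* Thue's lemma: the values a - x b with 0 <= a, b < sqrt p + 1 cannot be
   distinct mod p, where x is a primitive cube root of unity. *)
Lemma prime_norm_multiple p k : prime p -> p %% 3 = 1 -> p < k.+1 ^ 2 ->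
  exists a b, [/\ a <= k, b <= k, (a, b) != (0, 0)
    & p %| a ^ 2 + a * b + b ^ 2 \/ p %| a ^ 2 + b ^ 2 - a * b].
Proof.
move=> pp p3 pk.
have [|x x0] := @cube_root_exists 'F_p; first by rewrite card_Fp.
pose f (z : 'I_k.+1 * 'I_k.+1) : 'F_p := (z.1%:R - x * z.2%:R)%R.
have /injectivePn[[i1 j1] [[i2 j2] ne ef]] : ~~ injectiveb f.
  apply/negP => /injectiveP /leq_card; rewrite card_prod !card_ord Fp_cast //.
  by rewrite leqNgt pk.
rewrite /f /= in ef.
(* With truncated subtraction these are |i1 - i2| and |j1 - j2|. The collision gives a = x b or a =
   - x b mod p; the two signs lead to the two forms. *)
pose a := (i1 - i2) + (i2 - i1); pose b := (j1 - j2) + (j2 - j1).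
exists a, b; split.
- by have := ltn_ord i1; have := ltn_ord i2; rewrite /a; lia.
- by have := ltn_ord j1; have := ltn_ord j2; rewrite /b; lia.
- apply: contra ne => /eqP[a0 b0]; rewrite xpair_eqE.
  by move: a0 b0; rewrite /a /b => a0 b0; apply/andP; split; apply/eqP/val_inj => /=; lia.
have [e|e] : (a%:R = x * b%:R :> 'F_p \/ a%:R = - (x * b%:R) :> 'F_p)%R.
- have {}ef : (i1%:R - i2%:R = x * (j1%:R - j2%:R) :> 'F_p)%R.
    by rewrite mulrBr -[(x * j1%:R)%R](subrK i1%:R%R) -[(_ - i1%:R)%R]opprB ef; ring.
  have dist (m n : nat) : ((m - n + (n - m))%N%:R = m%:R - n%:R :> 'F_p \/
      (m - n + (n - m))%N%:R = - (m%:R - n%:R) :> 'F_p)%R.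
    have [le|/ltnW le] := leqP n m; have /eqP z := le.
      by left; rewrite z addn0 natrB.
    by right; rewrite z add0n natrB // opprB.
  case: (dist i1 i2) (dist j1 j2) => -> [] ->; rewrite ef; [left|right|right|left]; ring.
- left; rewrite Fp_nat_eq0 // !natrD natrM !natrX e.
  by apply/eqP; transitivity (b%:R ^+ 2 * (x ^+ 2 + x + 1))%R; [ring | rewrite x0 mulr0].
right; rewrite Fp_nat_eq0 // natrB; last by nia.
rewrite natrD natrM !natrX e.
by apply/eqP; transitivity (b%:R ^+ 2 * (x ^+ 2 + x + 1))%R; [ring | rewrite x0 mulr0].
Qed.

Lemma norm_even a b : ~~ odd (a ^ 2 + a * b + b ^ 2) -> ~~ odd a && ~~ odd b.
Proof. by rewrite !oddD oddM !oddX /=; case: (odd a); case: (odd b). Qed.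

Lemma prime_norm p : prime p -> p %% 3 = 1 ->
  exists a b, [/\ 0 < a, 0 < b & p = a ^ 2 + a * b + b ^ 2].
Proof.
move=> pp p3; have [k kp pk] := prime_sqrt_bracket _ pp.
have [a [b [ak bk ab0 d]]] := prime_norm_multiple _ _ pp p3 pk.
have a2 : a ^ 2 <= k ^ 2 by rewrite leq_exp2r.
have b2 : b ^ 2 <= k ^ 2 by rewrite leq_exp2r.
have ab2 : a * b <= k ^ 2 by rewrite expnS expn1 leq_mul.
have nab : (0 < a) || (0 < b) by case: (a) (b) ab0 => [|?] [|?].
(* The other form is excluded: a^2 + b^2 - a b is positive and at most max(a, b)^2 <= k^2 < p. *)
have {d} d : p %| a ^ 2 + a * b + b ^ 2.
  case: d => // /dvdn_leq le.
  have : 0 < a ^ 2 + b ^ 2 - a * b by nia.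
  move/le; have [ab|/ltnW ba] := leqP a b.
    have : a ^ 2 <= a * b by rewrite expnS expn1 leq_mul2l ab orbT.
    lia.
  have : b ^ 2 <= a * b by rewrite expnS expn1 leq_mul2r ba orbT.
  lia.
(* If c were 0, p would divide e^2, which lies strictly between 0 and p. *)
have pos c e : (0 < c) || (0 < e) -> e ^ 2 <= k ^ 2 ->
    p %| c ^ 2 + c * e + e ^ 2 -> 0 < c.
  case: c => //= e0 ek; rewrite mul0n exp0n // !add0n => /dvdn_leq.
  by rewrite expn_gt0 e0 => /(_ isT); lia.
have a0 : 0 < a := pos a b nab b2 d.
have b0 : 0 < b.
  by apply: (pos b a) => //; rewrite 1?orbC // mulnC addnAC [X in X + _]addnC addnAC.
exists a, b; split=> //.
case/dvdnP: (d) => q Eq.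
have Q0 : 0 < a ^ 2 + a * b + b ^ 2 by rewrite addn_gt0 expn_gt0 b0 orbT.
(* Q(a, b) <= 3 k^2 < 3 p. The case q = 2 makes a and b even, hence p even, so p = 2, which is not 1
   mod 3. *)
have q3 : q < 3 by rewrite -(ltn_pmul2r (prime_gt0 pp)) -Eq; lia.
case: q q3 Eq => [|[|[|//]]] _ Eq; [by rewrite Eq in Q0 | by rewrite Eq mul1n |].
have /andP[oa ob] : ~~ odd a && ~~ odd b by apply: norm_even; rewrite Eq oddM.
have [u Eu] : exists u, a = 2 * u by exists a./2; lia.
have [v Ev] : exists v, b = 2 * v by exists b./2; lia.
have Ep : p = 2 * (u ^ 2 + u * v + v ^ 2).
  by apply/eqP; rewrite -(eqn_pmul2l (isT : 0 < 2)) -Eq Eu Ev; apply/eqP; ring.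
have [p2|] := even_prime pp; first by rewrite p2 in p3.
by rewrite Ep oddM.
Qed.

Lemma prime_norm_coprime a b : prime (a ^ 2 + a * b + b ^ 2) -> coprime a b.
Proof.
move=> pp; set e := gcdn a b.
have [/dvdnP[u Eu] /dvdnP[v Ev]] : e %| a /\ e %| b by rewrite dvdn_gcdl dvdn_gcdr.
have EQ : a ^ 2 + a * b + b ^ 2 = e * (e * (u ^ 2 + u * v + v ^ 2)) by rewrite Eu Ev; ring.
rewrite EQ in pp; have [_ /(_ e)] := primeP pp.
rewrite dvdn_mulr // => /(_ isT) /orP[/eqP e1|/eqP ee]; first by rewrite /coprime -/e e1.
have e2 : 1 < e by rewrite ee prime_gt1.
have : e * 1 = e * (e * (u ^ 2 + u * v + v ^ 2)) by rewrite muln1.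
move/eqP; rewrite eqn_pmul2l; last by lia.
by rewrite eq_sym muln_eq1 => /andP[/eqP e1]; rewrite e1 in e2.
Qed.

(** * Divisibility and uniqueness via m^2 + n^2 - m n *)

(** [N] is m^2 + n^2 - m n, specified without subtraction. Modulo m a + n b, N a^2 is congruent to
    n^2 Q(a, b), and r does not divide a. *)
Lemma prime_dvd_conorm m n N a b r :
  coprime a b -> prime r -> r %| a ^ 2 + a * b + b ^ 2 -> r %| m * a + n * b ->
  N + m * n = m ^ 2 + n ^ 2 -> r %| N.
Proof.
move=> co pr rQ rT EN; have ra := prime_dvd_norm_ndvdl _ _ _ co pr rQ.
have : r %| N * a ^ 2 + (m * a + n * b) * (n * a + n * b).
  rewrite (_ : _ + _ = (m * a + n * b) * (m * a) + n ^ 2 * (a ^ 2 + a * b + b ^ 2)).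
    by rewrite dvdn_add // ?(dvdn_mulr _ rT) ?(dvdn_mull _ rQ).
  apply: (@addnI (m * n * a ^ 2)).
  transitivity ((N + m * n) * a ^ 2 + (m * a + n * b) * (n * a + n * b)); first by ring.
  by rewrite EN; ring.
by rewrite dvdn_addl ?(dvdn_mulr _ rT) // Euclid_dvdM // Euclid_dvdX // andbT (negbTE ra) orbF.
Qed.

(** Q(a, b) > 1 is a power of 3 not divisible by 9, so it equals 3. *)
Lemma norm_only_prime_3 a b : 0 < a -> 0 < b -> coprime a b ->
  (forall r, prime r -> r %| a ^ 2 + a * b + b ^ 2 -> r = 3) -> a = 1 /\ b = 1.
Proof.
move=> a0 b0 co H; have n9 := not_9_dvd_norm _ _ co.
have Q1 : 1 < a ^ 2 + a * b + b ^ 2.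
  have := expn_gt0 a 2; have := expn_gt0 b 2; rewrite a0 b0; lia.
have := pdiv_dvd (a ^ 2 + a * b + b ^ 2).
rewrite (H _ (pdiv_prime Q1) (pdiv_dvd _)) => /dvdnP[q Eq].
have q1 : q = 1.
  apply/eqP; apply: contraT => nq; have q2 : 1 < q by case: q Eq nq => [|[]] // E; rewrite E in Q1.
  have := H _ (pdiv_prime q2); rewrite Eq dvdn_mulr ?pdiv_dvd // => /(_ isT) E3.
  have := pdiv_dvd q; rewrite E3 => q3; case/negP: n9.
  by rewrite Eq (_ : 9 = 3 * 3) // dvdn_mul.
rewrite q1 mul1n in Eq.
have : 0 < a * b by rewrite muln_gt0 a0.
have : a <= a ^ 2 by rewrite expnS expn1 leq_pmulr.
have : b <= b ^ 2 by rewrite expnS expn1 leq_pmulr.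
lia.
Qed.

(* With w a primitive cube root of unity, m - c w and a - b w have norms p and
   Q, and (m - c w) conj(a - b w) = T + (T - S) w; taking norms gives
   p Q = T^2 - T S + S^2 >= 3 T^2 / 4. *)
Lemma prime_conorm_unique m c a b :
  0 < m -> coprime m c -> 0 < a -> 0 < b -> coprime a b ->
  prime (m ^ 2 + m * c + c ^ 2) ->
  m ^ 2 + m * c + c ^ 2 %| a ^ 2 + a * b + b ^ 2 ->
  a ^ 2 + a * b + b ^ 2 %| m * a + (m + c) * b ->
  a = m /\ b = c.
Proof.
move=> m0 co a0 b0 coab pp /dvdnP[h Eh] /dvdnP[g Eg].
set p := m ^ 2 + m * c + c ^ 2 in pp Eh; set T := m * a + (m + c) * b in Eg.
pose S := m * a + c * a + c * b.
have NE : p * (a ^ 2 + a * b + b ^ 2) + T * S = T ^ 2 + S ^ 2 by rewrite /p /T /S; ring.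
have T0 : 0 < T by rewrite addn_gt0 muln_gt0 m0 a0.
have S0 : 0 < S by rewrite !addn_gt0 !muln_gt0 m0 a0.
have p0 := prime_gt0 pp.
rewrite Eg Eh in T0 NE.
have [h0 g0] : 0 < h /\ 0 < g by move: T0; rewrite !muln_gt0; lia.
(* Substituting Q = h p and T = g h p in 4 p Q >= 3 T^2; after cancellation 3 h g^2 <= 4 forces h =
   g = 1. *)
have le : h * (h * g ^ 2 * 3) * p ^ 2 <= h * 4 * p ^ 2.
  by have := (nat_Cauchy T (2 * S)).1; rewrite Eg Eh; lia.
rewrite leq_pmul2r ?expn_gt0 ?p0 // leq_pmul2l // in le.
have /eqP : h * g ^ 2 = 1.
  have : 0 < h * g ^ 2 by rewrite muln_gt0 h0 expn_gt0 g0.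
  by clear -le; lia.
rewrite muln_eq1 => /andP[/eqP h1]; rewrite -(exp1n 2) eqn_exp2r // => /eqP g1.
rewrite h1 g1 !mul1n in NE Eg Eh.
(* Now T = Q = p, so the norm identity gives S = p = T. Since T - S = m b - c a, the coprime pairs
   (a, b) and (m, c) are proportional. *)
have ESp : S = p.
  have : S * p = S * S by rewrite [S * p]mulnC; clear -NE; lia.
  by move/eqP; rewrite eqn_pmul2l // => /eqP.
have mb : m * b = c * a by rewrite Eh -ESp /T /S in Eg; clear -Eg; lia.
have dam : a %| m by rewrite -(Gauss_dvdl _ coab) mb dvdn_mull.
have dma : m %| a by rewrite -(Gauss_dvdr _ co) -mb dvdn_mulr.
have am : a = m by apply/eqP; rewrite eqn_dvd dam.
by split=> //; apply/eqP; rewrite -(eqn_pmul2l m0) mb am mulnC.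
Qed.

Lemma norm_quotientE M1 M2 q : 0 < M1 ->
  norm_quotient M1 M2 = (q%:R)%R <->
  M1 ^ 2 + M2 ^ 2 = q * gcdn M1 M2 ^ 2 + M1 * M2.
Proof.
move=> M0; have d0 : ((gcdn M1 M2)%:R ^+ 2 != 0 :> rat)%R.
  by rewrite expf_neq0 // pnatr_eq0 -lt0n gcdn_gt0 M0.
rewrite /norm_quotient; split=> [e|e].
  by apply/eqP; rewrite -(eqr_nat rat) !natrD !natrX 2!natrM natrX -e divfK // subrK.
apply: (mulIf d0); rewrite divfK //; apply/eqP; rewrite subr_eq.
by rewrite -!natrX -!natrM -!natrD e.
Qed.

Lemma pos_solution_trivial M1 M2 : 0 < M1 -> M1 < M2 ->
  pos_solution M1 M2 (M1, M2 - M1).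
Proof.
move=> M0 lt; apply/pos_solutionE; rewrite subn_gt0; split=> //.
by move: (M2 - M1) (subnKC (ltnW lt)) => D <-; ring.
Qed.

Lemma unique_pos_solution_trivial M1 M2 XY : 0 < M1 -> M1 < M2 ->
  unique (pos_solution M1 M2) XY -> XY = (M1, M2 - M1).
Proof. by move=> M0 lt [_]; apply; exact: pos_solution_trivial. Qed.

(** For M1 = M2 the equation is symmetric, so uniqueness forces X = Y, and 3 X^2 = 2 M X remains. *)
Lemma unique_pos_solution_eq M XY :
  unique (pos_solution M M) XY -> XY.1 = XY.2 /\ 3 * XY.1 = 2 * M.
Proof.
case: XY => X Y [/pos_solutionE[X0 Y0 e] U] /=.
have /U[XY] : pos_solution M M (Y, X) by apply/pos_solutionE; split=> //; lia.
rewrite -XY in e *; split=> //.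
by apply/eqP; rewrite -(eqn_pmul2r X0); apply/eqP; lia.
Qed.

(** * Consequences of uniqueness *)

Section Necessity.
Variables (M1 M2 : nat) (XY : nat * nat).
Hypotheses (M1_gt0 : 0 < M1) (U : unique (pos_solution M1 M2) XY).
Let d := gcdn M1 M2.

Lemma unique_prime_dvd_gcd p : prime p -> p %| d -> p %% 3 != 1.
Proof.
move=> pp pd; apply/eqP => p3; have [a [b [a0 b0 Ep]]] := prime_norm _ pp p3.
have pT u v : p %| M1 * u + M2 * v.
  by rewrite dvdn_add // dvdn_mulr // (dvdn_trans pd) ?dvdn_gcdl ?dvdn_gcdr.
have [|g g0 s1] := pos_solution_of_dvd _ M2 _ _ M1_gt0 a0 b0; first by rewrite -Ep.
have [|h h0 s2] := pos_solution_of_dvd _ M2 _ _ M1_gt0 b0 a0.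
  by rewrite (_ : b ^ 2 + b * a + a ^ 2 = p) ?pT // Ep; ring.
have := (esym (U.2 _ s1)); rewrite (U.2 _ s2) => -[e1 e2].
(* Adding the coordinates gives g (a + b) = h (a + b); then a = b and p = 3 b^2, against p = 1 mod
   3. *)
have gh : g = h.
  by apply/eqP; rewrite -(eqn_pmul2r (_ : 0 < a + b)) ?addn_gt0 ?a0 // !mulnDr e1 e2 addnC.
have ab : a = b by apply/eqP; rewrite -(eqn_pmul2l g0) e1 gh.
have : 3 %| p by rewrite Ep ab (_ : _ + _ = b ^ 2 * 3) ?dvdn_mull //; ring.
by rewrite /dvdn p3.
Qed.

(** The direction (1, 1), where Q = 3, would give a point with equal coordinates; the known solution
    has them equal only if M2 = 2 M1. *)
Lemma unique_sum_ndvd3 : M1 < M2 -> M2 != 2 * M1 -> ~~ (3 %| M1 + M2).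
Proof.
move=> lt ne; apply/negP => d3.
have [|g _ s] := pos_solution_of_dvd _ M2 1 1 M1_gt0 isT isT; first by rewrite !muln1.
have := U.2 _ s; rewrite (unique_pos_solution_trivial _ _ _ M1_gt0 lt U) => -[].
by move: ne; rewrite !muln1 => /eqP; lia.
Qed.

Lemma unique_conorm_prime m c : coprime m c -> 0 < c -> M1 = d * m -> M2 = d * (m + c) ->
  c != m -> let q := m ^ 2 + m * c + c ^ 2 in prime q /\ q %% 3 = 1.
Proof.
move=> co c0 E1 E2 cm q.
have d0 : 0 < d by rewrite gcdn_gt0 M1_gt0.
have m0 : 0 < m by move: M1_gt0; rewrite E1 muln_gt0 => /andP[].
have lt : M1 < M2 by rewrite E1 E2 ltn_pmul2l // -addn1 leq_add2l.
have XYE := unique_pos_solution_trivial _ _ _ M1_gt0 lt U.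
have ED : M2 - M1 = d * c by rewrite E1 E2 mulnDr addKn.
have q1 : 1 < q.
  by rewrite /q; have := expn_gt0 m 2; have := expn_gt0 c 2; rewrite m0 c0; lia.
set p := pdiv q; have pp : prime p := pdiv_prime q1.
have pq : p %| q := pdiv_dvd q.
have p3 : p %% 3 = 1.
  have [e3|//] := prime_dvd_norm _ _ _ co pp pq.
  have /negP[] : ~~ (3 %| M1 + M2).
    apply: unique_sum_ndvd3 => //; apply: contra cm => /eqP e.
    by rewrite -(eqn_pmul2l d0); apply/eqP; lia.
  rewrite E1 E2 -mulnDr dvdn_mull //.
  (* In this branch 3 divides q = Q(m, c), hence also (2 m + c)^2. *)
  have : 3 %| (m + (m + c)) ^ 2.
    rewrite (_ : _ ^ 2 = 3 * (m ^ 2 + m * c) + q); last by rewrite /q; ring.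
    by rewrite dvdn_add ?dvdn_mulr // -e3.
  by rewrite Euclid_dvdX // andbT.
have [a [b [a0 b0 Ep]]] := prime_norm _ pp p3.
have coab : coprime a b by apply: prime_norm_coprime; rewrite -Ep.
suff qp u v : 0 < u -> 0 < v -> coprime u v -> p = u ^ 2 + u * v + v ^ 2 ->
    p %| m * u + (m + c) * v -> q = p.
  suff -> : q = p by [].
  (* The product equals m (m + c) p + a b q, so p divides one factor and (a, b) or (b, a) is the
     direction of a solution. *)
  have : p %| (m * a + (m + c) * b) * (m * b + (m + c) * a).
    rewrite (_ : _ * _ = m * (m + c) * p + a * b * q); last by rewrite Ep /q; ring.
    by rewrite dvdn_add ?dvdn_mull.
  rewrite Euclid_dvdM // => /orP[]; first exact: qp.
  by apply: qp; rewrite // 1?coprime_sym // Ep; ring.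
move=> u0 v0 cuv Eu pT.
have [|g _ s] := pos_solution_of_dvd M1 M2 _ _ M1_gt0 u0 v0.
  by rewrite -Eu E1 E2 -!mulnA -mulnDr dvdn_mull.
have := U.2 _ s; rewrite XYE ED E1 => -[e1 e2].
(* Compare the gcds of the coordinates; both directions are coprime pairs. *)
have gd : d = g.
  have : gcdn (d * m) (d * c) = gcdn (g * u) (g * v) by rewrite e1 e2.
  by rewrite -!muln_gcdr (eqP co) (eqP cuv) !muln1.
rewrite -gd in e1 e2.
have /eqP := e1; rewrite eqn_pmul2l // => /eqP mu.
have /eqP := e2; rewrite eqn_pmul2l // => /eqP cv.
by rewrite /q mu cv -Eu.
Qed.
End Necessity.

(** * Uniqueness in the three cases *)

Lemma prime_dvd_norm_conorm d m n N g a b r :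
  coprime a b -> N + m * n = m ^ 2 + n ^ 2 ->
  g * (a ^ 2 + a * b + b ^ 2) = d * m * a + d * n * b ->
  prime r -> r %| a ^ 2 + a * b + b ^ 2 -> ~~ (r %| d) -> r %| N.
Proof.
move=> co EN eg pr rQ rd; apply: (prime_dvd_conorm m n N a b) => //.
have : r %| d * (m * a + n * b) by rewrite mulnDr !mulnA -eg dvdn_mull.
by rewrite Euclid_dvdM // (negbTE rd).
Qed.

Lemma unique_pos_solution_diag M : 0 < M -> 3 %| M ->
  (forall r, prime r -> r %% 3 = 1 -> ~~ (r %| M)) ->
  unique (pos_solution M M) (2 * (M %/ 3), 2 * (M %/ 3)).
Proof.
move=> M0 /dvdnP[t Et] H; rewrite Et mulnK //.
have t0 : 0 < t by lia.
split=> [|[X Y] s].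
  by apply/pos_solutionE; rewrite muln_gt0 t0; split=> //; ring.
have [g [a [b [-> -> [g0 a0 b0] co eg]]]] := pos_solution_coprime _ _ _ _ s.
have [] := norm_only_prime_3 a b a0 b0 co; last first.
  by move=> a1 b1; rewrite a1 b1 in eg *; congr pair; lia.
move=> r pr rQ; have [//|r1] := prime_dvd_norm _ _ _ co pr rQ.
have : r %| 1.
  apply: (prime_dvd_norm_conorm M 1 1 1 g a b) => //; last exact: H.
  by rewrite !muln1 eg -Et.
by rewrite dvdn1 => /eqP e; rewrite e in pr.
Qed.

Lemma unique_pos_solution_double M : 0 < M ->
  (forall r, prime r -> r %% 3 = 1 -> ~~ (r %| M)) ->
  unique (pos_solution M (2 * M)) (M, M).
Proof.
move=> M0 H; split=> [|[X Y] s]; first by apply/pos_solutionE; split=> //; ring.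
have [g [a [b [-> -> [g0 a0 b0] co eg]]]] := pos_solution_coprime _ _ _ _ s.
have [] := norm_only_prime_3 a b a0 b0 co; last first.
  by move=> a1 b1; rewrite a1 b1 in eg *; congr pair; lia.
move=> r pr rQ; have [//|r1] := prime_dvd_norm _ _ _ co pr rQ.
have : r %| 3.
  apply: (prime_dvd_norm_conorm M 1 2 3 g a b) => //; last exact: H.
  by rewrite muln1 (mulnC M 2) eg.
by rewrite dvdn_prime2 // => /eqP.
Qed.

(** For a solution of direction (a, b), every prime divisor of Q(a, b) equals p = Q(m, c) and none
    divides d. So p divides Q(a, b), which divides m a + (m + c) b, and [prime_conorm_unique]
    applies. *)
Lemma unique_pos_solution_prime_conorm d m c :
  0 < d -> 0 < m -> 0 < c -> coprime m c ->
  prime (m ^ 2 + m * c + c ^ 2) -> (m ^ 2 + m * c + c ^ 2) %% 3 = 1 -> ~~ (3 %| d) ->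
  (forall r, prime r -> r %% 3 = 1 -> ~~ (r %| d)) ->
  unique (pos_solution (d * m) (d * (m + c))) (d * m, d * c).
Proof.
move=> d0 m0 c0 co pp p3 d3 H; split=> [|[X Y] s].
  by apply/pos_solutionE; rewrite !muln_gt0 d0 m0 c0; split=> //; ring.
have [g [a [b [-> -> [g0 a0 b0] coab eg]]]] := pos_solution_coprime _ _ _ _ s.
set p := m ^ 2 + m * c + c ^ 2 in pp p3.
have rd r : prime r -> r %| a ^ 2 + a * b + b ^ 2 -> ~~ (r %| d).
  by move=> pr rQ; have [->|] := prime_dvd_norm _ _ _ coab pr rQ; [|exact: H].
have rp r : prime r -> r %| a ^ 2 + a * b + b ^ 2 -> r = p.
  move=> pr rQ; apply/eqP; rewrite -dvdn_prime2 //.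
  apply: (prime_dvd_norm_conorm d m (m + c) p g a b) => //; last exact: rd.
  by rewrite /p; ring.
have Q1 : 1 < a ^ 2 + a * b + b ^ 2.
  by have := expn_gt0 a 2; have := expn_gt0 b 2; rewrite a0 b0; lia.
have coQd : coprime (a ^ 2 + a * b + b ^ 2) d.
  rewrite /coprime eqn_leq gcdn_gt0 d0 orbT andbT leqNgt; apply/negP => /pdivP[r pr].
  by rewrite dvdn_gcd => /andP[rQ]; apply/negP/rd.
have [am bc] : a = m /\ b = c.
  apply: prime_conorm_unique => //.
    by rewrite -/p -(rp _ (pdiv_prime Q1) (pdiv_dvd _)) pdiv_dvd.
  by rewrite -(Gauss_dvdr _ coQd) mulnDr !mulnA -eg dvdn_mull.
rewrite am bc -/p in eg *; suff -> : g = d by [].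
apply/eqP; rewrite -(eqn_pmul2r (prime_gt0 pp)) eg /p; apply/eqP; ring.
Qed.

Theorem proposition3p10 (M1 M2 : nat) (hM1 : 0 < M1) (hM12 : M1 <= M2) :
  ((exists! XY : nat * nat, pos_solution M1 M2 XY) <->
   [/\ forall p : nat, prime p -> p %| gcdn M1 M2 ->
         [\/ p = 2, p = 3 | form_6k_minus_1 p],
       M1 = M2 -> 3 %| gcdn M1 M2
     & M2 \notin [:: M1; 2 * M1] ->
         ~~ (3 %| gcdn M1 M2) /\
         (exists q : nat, [/\ norm_quotient M1 M2 = (q%:R)%R,
                              prime q & form_6m_plus_1 q])])
  /\
  (forall X Y : nat, unique (pos_solution M1 M2) (X, Y) ->
     (M1 < M2 -> (X, Y) = (M1, M2 - M1)) /\
     (M1 = M2 -> (X%:R = 2 / 3 * M1%:R :> rat)%R /\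
                 (Y%:R = 2 / 3 * M1%:R :> rat)%R)).
Proof.
split; last first.
  move=> X Y U; split=> [lt|e]; first exact: (unique_pos_solution_trivial _ _ _ hM1 lt U).
  rewrite -e in U; have [/= <- E] := unique_pos_solution_eq _ _ U.
  suff -> : (X%:R = 2 / 3 * M1%:R :> rat)%R by [].
  have E' : (3 * X%:R = 2 * M1%:R :> rat)%R by rewrite -!natrM E.
  by rewrite mulrAC -E' mulrAC divff // mul1r.
set d := gcdn M1 M2; have d0 : 0 < d by rewrite gcdn_gt0 hM1.
have [m Em] : exists m, M1 = d * m by exists (M1 %/ d); rewrite mulnC divnK ?dvdn_gcdl.
have [n En] : exists n, M2 = d * n by exists (M2 %/ d); rewrite mulnC divnK ?dvdn_gcdr.
have m0 : 0 < m by move: hM1; rewrite Em muln_gt0 => /andP[].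
have comn : coprime m n by rewrite /coprime -(eqn_pmul2l d0) muln_gcdr -Em -En muln1.
have mn : m <= n by rewrite -(leq_pmul2l d0) -Em -En.
have [c Ec] : exists c, n = m + c by exists (n - m); rewrite subnKC.
have co : coprime m c by rewrite /coprime -(gcdnDl m c) -Ec.
(* With n = m + c, m^2 + n^2 - m n is Q(m, c). *)
have conorm q : norm_quotient M1 M2 = (q%:R)%R <-> q = m ^ 2 + m * c + c ^ 2.
  rewrite norm_quotientE // -/d; split=> [e|->]; last by rewrite Em En Ec; ring.
  apply/eqP; rewrite -(eqn_pmul2r (_ : 0 < d ^ 2)) ?expn_gt0 ?d0 //.
  rewrite -(eqn_add2r (M1 * M2)) -e; apply/eqP; rewrite Em En Ec; ring.
have odd_prime p : prime p -> p = 2 \/ odd p by exact: even_prime.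
split=> [[XY U]|[C1 C2 C3]].
  split=> [p pp pd|e|].
  - have := unique_prime_dvd_gcd _ _ _ hM1 U p pp pd.
    case: (odd_prime p pp) => [->|op] p3; first exact: Or31.
    have [p0|p0] := eqVneq (p %% 3) 0.
      have : 3 %| p by rewrite /dvdn p0.
      by rewrite dvdn_prime2 // => /eqP <-; apply: Or32.
    (* Here p is odd and 2 mod 3, hence 5 mod 6. *)
    by apply: Or33; exists (p %/ 6).+1 => //; lia.
  - rewrite /d -e gcdnn; rewrite -e in U; have [_ E] := unique_pos_solution_eq _ _ U.
    by rewrite -(@Gauss_dvdr 3 2) // -E dvdn_mulr.
  rewrite !inE negb_or => /andP[ne1 ne2].
  have lt : M1 < M2 by rewrite ltn_neqAle eq_sym ne1.
  have c0 : 0 < c by move: lt; rewrite Em En Ec ltn_pmul2l //; lia.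
  have cm : c != m.
    by apply: contra ne2 => /eqP e; rewrite En Ec e Em; apply/eqP; ring.
  have En' : M2 = d * (m + c) by rewrite En Ec.
  have [pq q3] := unique_conorm_prime _ _ _ hM1 U _ _ co c0 Em En' cm.
  split.
    apply/negP => d3; case/negP: (unique_sum_ndvd3 _ _ _ hM1 U lt ne2).
    by rewrite dvdn_add // (dvdn_trans d3) ?dvdn_gcdl ?dvdn_gcdr.
  exists (m ^ 2 + m * c + c ^ 2); split=> //; first by apply/conorm.
  move: (m ^ 2 + m * c + c ^ 2) pq q3 => q pq q3.
  have q1 := prime_gt1 pq.
  by case: (odd_prime q pq) => [e|oq]; [rewrite e in q3 | exists (q %/ 6); lia].
(* The primes allowed by the first condition are 0 or 2 mod 3. *)
have H r : prime r -> r %% 3 = 1 -> ~~ (r %| d).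
  move=> pr r3; apply/negP => rd; case: (C1 r pr rd) => [e|e|[k k0 e]]; rewrite e in r3 => //.
  lia.
have [e|ne1] := eqVneq M2 M1.
  have dM : d = M1 by rewrite /d e gcdnn.
  rewrite dM in H C2; rewrite e.
  by exists (2 * (M1 %/ 3), 2 * (M1 %/ 3)); apply: unique_pos_solution_diag => //; apply: C2.
have [e|ne2] := eqVneq M2 (2 * M1).
  have dM : d = M1 by rewrite /d e gcdnMl.
  rewrite dM in H; rewrite e.
  by exists (M1, M1); apply: unique_pos_solution_double.
have [|d3 [q [/conorm Eq pq [k _ ek]]]] := C3; first by rewrite !inE negb_or ne1 ne2.
exists (d * m, d * c); rewrite {1}Em {1}En Ec; rewrite Eq in pq ek.
apply: unique_pos_solution_prime_conorm => //.
- by move: ne1; rewrite En Em Ec; case: (c) => //; rewrite addn0 eqxx.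
- by rewrite ek; lia.
Qed.
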